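(* The empty sash $\emptyset$ (of length $-1$) is the identity for the product $\bullet_S$. For sashes $A\neq\emptyset$ and $B\ne\emptyset$, $$A\bullet_S B=\begin{cases}\sum\left[A\,\mathsf b\,B,\ A'\,\mathsf r\,B\right] & \text{if } A=A'\,\mathsf b \text{ for some sash } A',\\[4pt] \sum\left[A\,\mathsf b\,B,\ A\,\mathsf w\,B\right] & \text{if } A \text{ is not of the form } A'\,\mathsf b,\end{cases}$$ where $\sum[D,E]$ denotes the sum of all sashes in the interval $[D,E]$ of the lattice of sashes of the appropriate length.
   Context: A sash of length $m\ge 0$ is a tiling of a $1\times m$ rectangle by black $1\times1$ squares ($\mathsf b$), white $1\times1$ squares ($\mathsf w$) and white $1\times2$ rectangles ($\mathsf r$, occupying two positions); it is written as a word in $\mathsf b,\mathsf w,\mathsf r$ from left to right, juxtaposition is concatenation. There is one sash of length $0$ (the empty word), and in addition a formal sash of length $-1$, denoted $\emptyset$. $\Sigma_m$ is the set of sashes of length $m$. $S_n$ is the set of permutations of $[n]=\{1,\dots,n\}$ ($S_0$ contains only the empty permutation $\emptyset$) with the weak order: $x\le x'$ iff every inversion of $x$ is an inversion of $x'$, an inversion of $x=x_1\cdots x_n$ being a pair of values $(x_i,x_j)$ with $i<j$, $x_i>x_j$. A Pell permutation is $x\in S_n$ such that $x_i-x_{i+1}\le 2$ for all $i$, and whenever $x_i=x_{i+1}+2$ the value $x_{i+1}+1$ appears to the right of $x_{i+1}$; $P_n$ is the set of Pell permutations in $S_n$ with the order induced by the weak order (a lattice). The map $\sigma:S_n\to\Sigma_{n-1}$: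 position $i$ ($1\le i\le n-1$) of $\sigma(x)$ is a black square if $i+1$ is to the right of $i$ in $x$, and a white square if $i+1$ is to the left of $i$, except that if $i+1$ is to the right of $i$ and $i+2$ is to the left of $i$ then a rectangle occupies positions $i$ and $i+1$; $\sigma(\emptyset)=\emptyset$ and $\sigma(1)$ is the sash of length $0$. Restricted to $P_n$, $\sigma$ is a bijection onto $\Sigma_{n-1}$; its inverse is denoted $\eta$. The partial order on $\Sigma_{n-1}$ is the one making $\sigma:P_n\to\Sigma_{n-1}$ an order isomorphism. Product: let $\mathbb K$ be a field, and extend $\sigma,\eta$ linearly. For $x\in S_p$, $y=y_1\cdots y_q\in S_q$, let $y'=(y_1+p)\cdots(y_q+p)$; $x\bullet y$ is the sum of all shifted shuffles, i.e. of all $z\in S_{p+q}$ such that the subword of $z$ on the values $1,\dots,p$ is $x$ and the subword on the values $p+1,\dots,p+q$ is $y'$. Let $\rho$ be the linear map with $\rho(z)=z$ if $z$ is a Pell permutation and $\rho(z)=0$ for all other permutations. For sashes $A,B$, $A\bullet_S B=\sigma\big(\rho(\eta(A)\bullet\eta(B))\big)$ (extended bilinearly to the $\mathbb K$-vector space with basis all sashes). *)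

(* Defs.v *)
From HB Require Import structures.
From mathcomp Require Import all_boot all_fingroup all_algebra.
From mathcomp.multinomials Require Import freeg.

Set Implicit Arguments.
Unset Strict Implicit.
Unset Printing Implicit Defensive.

Import GRing.Theory.
Local Open Scope ring_scope.

Inductive tile : Type := Black | White | Rect.

Definition tile_code (t : tile) : option bool :=
  match t with Black => Some true | White => Some false | Rect => None end.

Definition tile_decode (c : option bool) : tile :=
  match c with Some true => Black | Some false => White | None => Rect end.

Lemma tile_codeK : cancel tile_code tile_decode.
Proof. by case. Qed.

HB.instance Definition _ := Finite.copy tile (can_type tile_codeK).

Definition tile_length (t : tile) : nat := if t is Rect then 2%N else 1%N.

Definition word_length (s : seq tile) : nat := sumn (map tile_length s).

(* [None] is the formal sash of length -1; [Some [::]] is the sash of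
   length 0. *)
Definition sash : Type := option (seq tile).

(* Length plus one, so that the sashes of degree n form Sigma_(n-1). *)
Definition degree (A : sash) : nat :=
  if A is Some s then (word_length s).+1 else 0%N.

(* The sashes of length m >= 0; every tile has length at least 1, so they are
   words of at most m tiles. *)
Definition Sigma (m : nat) : {set m.-bseq tile} :=
  [set s : m.-bseq tile | word_length s == m].

(* The word x_1 ... x_n, with values in {1, ..., n}. *)
Definition oneline (n : nat) (x : 'S_n) : seq nat :=
  [seq (x i : nat).+1 | i : 'I_n].

(* The value b stands to the right of the value a in the word s. *)
Definition right_of (s : seq nat) (b a : nat) : bool :=
  (index a s < index b s)%N.

Definition inversions (n : nat) (x : 'S_n) : {set 'I_n * 'I_n} :=
  [set (x p.1, x p.2) | p : 'I_n * 'I_n & (p.1 < p.2)%N && (x p.2 < x p.1)%N].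

Definition weak_le (n : nat) (x y : 'S_n) : bool :=
  inversions x \subset inversions y.

Definition pell (n : nat) (x : 'S_n) : bool :=
  let s := oneline x in
  [forall i : 'I_n.-1,
     let a := nth 0%N s i in
     let b := nth 0%N s i.+1 in
     (a <= b + 2)%N && ((a == b + 2)%N ==> right_of s b.+1 b)].

Definition rect_at (n : nat) (x : 'S_n) (i : nat) : bool :=
  let s := oneline x in
  [&& (0 < i)%N, (i + 2 <= n)%N, right_of s (i + 1) i & right_of s i (i + 2)].

(* The tile starting at position i, or [None] if position i is the second half
   of a rectangle. *)
Definition tile_at (n : nat) (x : 'S_n) (i : nat) : option tile :=
  if rect_at x i.-1 then None
  else if rect_at x i then Some Rect
  else if right_of (oneline x) (i + 1) i then Some Black
  else Some White.

Definition sigma (n : nat) (x : 'S_n) : sash :=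
  if n is 0 then None else Some (pmap (tile_at x) (iota 1 n.-1)).

(* [eta n] is the inverse of the bijection sigma : P_n -> Sigma_(n-1); its
   value outside Sigma_(n-1) is irrelevant. *)
Definition eta (n : nat) (A : sash) : 'S_n :=
  odflt 1%g [pick x : 'S_n | pell x && (sigma x == A)].

(* The order of Sigma_(n-1), transported from P_n along sigma. *)
Definition sash_le (n : nat) (A B : sash) : bool :=
  [&& degree A == n, degree B == n & weak_le (eta n A) (eta n B)].

Definition perms : Type := {n : nat & 'S_n}.

Definition sash_space (K : fieldType) : lmodType K := {freeg sash / K}.

Definition perm_space (K : fieldType) : lmodType K := {freeg perms / K}.

Definition sash_basis (K : fieldType) (A : sash) : sash_space K := << A >>.

Definition perms_basis (K : fieldType) (n : nat) (x : 'S_n) : perm_space K :=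
  << (existT (fun m => 'S_m) n x : perms) >>.

Definition is_shifted_shuffle (p q : nat) (x : 'S_p) (y : 'S_q)
    (z : 'S_(p + q)) : bool :=
  ([seq v <- oneline z | (v <= p)%N] == oneline x) &&
  ([seq v <- oneline z | (p < v)%N] == [seq (v + p)%N | v <- oneline y]).

Definition shuffle_sum (K : fieldType) (p q : nat) (x : 'S_p) (y : 'S_q) :
    perm_space K :=
  \sum_(z : 'S_(p + q) | is_shifted_shuffle x y z) perms_basis K z.

Definition bullet (K : fieldType) (a b : perm_space K) : perm_space K :=
  fglift (fun x : perms =>
    fglift (fun y : perms => shuffle_sum K (tagged x) (tagged y)) b) a.

Definition rho_lin (K : fieldType) : perm_space K -> perm_space K :=
  fglift (fun x : perms =>
    if pell (tagged x) then perms_basis K (tagged x) else 0).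

Definition sigma_lin (K : fieldType) : perm_space K -> sash_space K :=
  fglift (fun x : perms => sash_basis K (sigma (tagged x))).

Definition eta_lin (K : fieldType) : sash_space K -> perm_space K :=
  fglift (fun A : sash => perms_basis K (eta (degree A) A)).

Definition bullet_S (K : fieldType) (a b : sash_space K) : sash_space K :=
  sigma_lin (rho_lin (bullet (eta_lin a) (eta_lin b))).

(* The sum of all sashes in [D, E], in the poset of sashes of the length of
   D. *)
Definition interval_sum (K : fieldType) (D E : seq tile) : sash_space K :=
  let m := word_length D in
  \sum_(C in Sigma m | sash_le m.+1 (Some D) (Some (C : seq tile)) &&
                       sash_le m.+1 (Some (C : seq tile)) (Some E))
     sash_basis K (Some (C : seq tile)).

(* Main.v *)
From HB Require Import structures.
Require Import Defs.
From mathcomp Require Import all_boot all_fingroup all_algebra.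
From mathcomp.multinomials Require Import freeg.
From mathcomp Require Import zify.

(** The inversions of a Pell permutation can be read off its sash. For values
    a < c, the value c stands to the left of a exactly when none of the
    positions a, ..., c-1 is a black square and no rectangle starts at c-1
    ([pell_right_of], [right_of_sash_inv]). Indeed, walking through the one-line
    word from c to a, each step down is at most 2, so the first value below c is
    c-1, or c-2 with c-1 further to the right ([pell_first_descent]); this is a
    white square at c-1 in the first case and a rectangle at c-2 in the second,
    and an induction on c continues from there. Hence a Pell permutation is
    determined by its sash, every sash comes from one (insert the new largest
    value n+1 at the end for a last tile b, just before n for w; for r, insert n+1
    at the end and then n+2 just before n: [pell_model_exists]), and the order on sashes is an inclusion between sets of
    pairs (a, c) described by tiles.

    Now let x in S_p and y in S_q be the Pell permutations of A and B. A
    permutation z of p+q is a shifted shuffle of x and y exactly when it orders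
    the low values 1, ..., p as x does and the high values as y does
    ([shuffle_agree]). The permutations of both ends of the interval have this
    property. At the lower end A b B the black square at position p forbids any
    inversion between a low and a high value, so this end is the least such
    permutation. The upper end has the form F B, where F is A' r or A w: it has
    no black square at p-1 or p and no rectangle starting at p, so that an
    inversion (c, a) with a <= p < c is only excluded by tiles that depend on the
    orders of x and of y alone. Every Pell shuffle z has those tiles as well, so
    it lies below F B ([sash_inv_cross]). Conversely, what lies between two
    permutations that agree on the low values and on the high values agrees with
    both. So the Pell shuffles of x and y are the elements of the interval
    ([agree_interval]), and summing their sashes gives the formula.

    The combinatorics is done on words, that is on one-line notations as lists of
    numbers, because the insertions change the symmetric group.
    For the identity, linearity reduces to basis elements, where the empty
    permutation has a single shuffle with any other ([bullet_S_None_basis],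
    [bullet_S_basis_None]). *)

Set Implicit Arguments.
Unset Strict Implicit.
Unset Printing Implicit Defensive.

Import GRing.Theory.

(** * Words and their tiles *)

Definition perm_word (s : seq nat) : bool := perm_eq s (iota 1 (size s)).

Lemma perm_word_uniq s : perm_word s -> uniq s.
Proof. by move=> /perm_uniq->; rewrite iota_uniq. Qed.

Lemma mem_perm_word s v : perm_word s -> (v \in s) = (0 < v <= size s).
Proof. by move=> /perm_mem->; rewrite mem_iota; lia. Qed.

Lemma right_of_irr s a : right_of s a a = false.
Proof. exact: ltnn. Qed.

Lemma right_of_trans s b a c : right_of s b a -> right_of s c b -> right_of s c a.
Proof. exact: ltn_trans. Qed.

Lemma right_ofN s a b : a \in s -> a != b -> ~~ right_of s b a = right_of s a b.
Proof.
move=> sa ab; rewrite /right_of -leqNgt leq_eqVlt -[RHS]orFb; congr (_ || _).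
apply/negP => /eqP eqi; case: (boolP (b \in s)) => sb.
  by move: ab; rewrite -(nth_index 0%N sa) -eqi nth_index ?eqxx.
by move: sa; rewrite -index_mem -eqi (memNindex sb) ltnn.
Qed.

Definition rect_word (s : seq nat) (i : nat) : bool :=
  [&& 0 < i, i.+2 <= size s, right_of s i.+1 i & right_of s i i.+2].

(** The values i and i+1 stand in increasing order at a black square and at the first
    half of a rectangle, but never at a second half ([right_of_rectN]). *)
Definition black_word (s : seq nat) (i : nat) : bool :=
  right_of s i.+1 i && ~~ rect_word s i.

Definition tile_word (s : seq nat) (i : nat) : option tile :=
  if rect_word s i.-1 then None
  else if rect_word s i then Some Rect
  else if right_of s i.+1 i then Some Black
  else Some White.

Lemma rect_wordS s i : rect_word s i -> right_of s i.+1 i.+2.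
Proof. by case/and4P=> _ _ h1 h2; apply: right_of_trans h2 h1. Qed.

(** The value i+1 is to the right of i+2 in a rectangle at i, and to its left in a
    rectangle at i+1. *)
Lemma rect_word_disjoint s i : rect_word s i -> ~~ rect_word s i.+1.
Proof.
move=> /rect_wordS h; apply/negP => /and4P[_ _ h' _].
by move: (right_of_trans h h'); rewrite right_of_irr.
Qed.

Lemma right_of_rectN s i : right_of s i.+1 i -> ~~ rect_word s i.-1.
Proof.
case: i => [|i] h; first by apply/negP => /and4P[].
apply/negP => /rect_wordS h'.
by move: (right_of_trans h h'); rewrite right_of_irr.
Qed.

Lemma tile_word_Rect s i : (tile_word s i == Some Rect) = rect_word s i.
Proof.
rewrite /tile_word; case: (boolP (rect_word s i)) => [h|h].
  by case/and4P: (h) => _ _ /right_of_rectN/negPf-> _.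
by case: ifP => // _; case: ifP.
Qed.

Lemma tile_word_Black s i : (tile_word s i == Some Black) = black_word s i.
Proof.
rewrite /tile_word /black_word; case: (boolP (right_of _ _ _)) => [h|h].
  by rewrite (negPf (right_of_rectN h)); case: ifP.
by case: ifP => // _; case: ifP.
Qed.

Definition pell_rel (s : seq nat) : rel nat :=
  fun a b => (a <= b + 2) && ((a == b + 2) ==> right_of s b.+1 b).

Definition pell_word (s : seq nat) : bool := sorted (pell_rel s) s.

(** * Inversions of a Pell permutation *)

(* [lia] splits on every boolean hypothesis; those on words carry no
   arithmetic, and clearing them keeps it fast. *)
Ltac order_lia :=
  repeat match goal with
  | H : context [@right_of] |- _ => clear H
  | H : context [@rect_word] |- _ => clear H
  | H : context [@black_word] |- _ => clear H
  | H : context [@pell_word] |- _ => clear H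
  | H : context [@perm_word] |- _ => clear H
  | H : context [@in_mem] |- _ => clear H
  end; lia.

(** The first value b below c after c follows a value that is at least c, and a
    step of a Pell word goes down by at most 2. *)
Lemma pell_first_descent s a c : uniq s -> pell_word s -> c \in s -> a \in s ->
  a < c -> right_of s a c ->
  exists b, [/\ (b == c.-1) || ((b == c - 2) && right_of s c.-1 b), b < c,
                b \in s, right_of s b c & (a == b) || right_of s a b].
Proof.
move=> Us /(sortedP 0%N) Ps sc sa ac lt_ca.
(* j is the position of the first value below c after c. *)
have ex_j : exists j, (index c s < j) && (nth 0 s j < c).
  by exists (index a s); rewrite nth_index // ac andbT.
case: (ex_minnP ex_j) => j /andP[cj jc] min_j {ex_j}.
have ja : j <= index a s by apply: min_j; rewrite nth_index // ac andbT.
have js : j < size s by apply: leq_ltn_trans ja _; rewrite index_mem.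
case: j => // j in cj jc min_j ja js *.
set b := nth 0 s j.+1 in jc *.
have jb : index b s = j.+1 by rewrite index_uniq.
have prev : c <= nth 0 s j.
  move: cj; rewrite ltnS leq_eqVlt => /orP[/eqP<-|cj]; first by rewrite nth_index.
  rewrite leqNgt; apply/negP => jc'.
  by have := min_j j; rewrite cj jc' ltnn => /(_ isT).
exists b; split=> //.
- have := Ps j js; rewrite -/b /pell_rel => /andP[le_b /implyP imp_b].
  case: (eqVneq b c.-1) => //= bc.
  (* the step must start from c itself and go down by exactly 2 *)
  have eq_b : b = c - 2 by order_lia.
  rewrite -eq_b eqxx /=.
  have ->: c.-1 = b.+1 by order_lia.
  apply: imp_b; order_lia.
- exact: mem_nth.
- by rewrite /right_of jb.
- rewrite /right_of jb; case: eqVneq => //= ab.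
  rewrite ltn_neqAle ja andbT; apply: contra ab => /eqP jab.
  by rewrite /b jab nth_index.
Qed.

(** Both directions are inductions on c. From left to right, the first value below
    c decides: c-1 leads to the pair (a, c-1), and c-2 to the pair (a, c-2) with a
    rectangle at c-2. From right to left, c is to the left of c-1, since
    position c-1 is a white square or the second half of a rectangle at c-2; in
    the latter case c is also to the left of c-2, and no rectangle can start at
    c-3. *)
Lemma pell_right_of s a c : perm_word s -> pell_word s ->
  0 < a -> a < c -> c <= size s ->
  right_of s a c <->
  (forall i, a <= i < c -> ~~ black_word s i) /\ ~~ rect_word s c.-1.
Proof.
move=> Ws Ps a0; have Us := perm_word_uniq Ws.
elim/ltn_ind: c => c IH ac cs.
have ms v : 0 < v -> v <= c -> v \in s.
  by move=> v0 vc; rewrite mem_perm_word //; order_lia.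
have NL u v : 0 < u -> u <= c -> 0 < v -> v <= c -> right_of s u v ->
    ~~ right_of s v u.
  move=> _ _ _ _ h'; apply/negP => h.
  by have := right_of_trans h h'; rewrite right_of_irr.
split.
- move=> Lca.
  have [] := pell_first_descent Us Ps (ms c _ _) (ms a _ _) ac Lca; try order_lia.
  move=> b [eb bc sb Lcb ab].
  have b0 : 0 < b by move: sb; rewrite mem_perm_word // => /andP[].
  case/orP: eb => [/eqP eb|/andP[/eqP eb Lb]].
  + have ec : c.-1.+1 = c by order_lia.
    have Nc : ~~ right_of s c b by apply: NL => //; order_lia.
    split; last by rewrite -eb; apply/negP => /and4P[_ _]; rewrite eb ec -eb (negPf Nc).
    move=> i /andP[ai ic]; case: (eqVneq i b) => ib.
      by rewrite /black_word ib {1}eb ec (negPf Nc).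
    have Lba : right_of s a b by case/orP: ab => // /eqP ?; order_lia.
    have /(IH b bc) IHb : a < b by order_lia.
    case: (proj1 (IHb _) Lba) => [|Hb _]; first by order_lia.
    by apply: Hb; order_lia.
  + have ec2 : b.+2 = c by order_lia. have ec1 : b.+1 = c.-1 by order_lia.
    have rb : rect_word s b.
      by rewrite /rect_word ec2 ec1 Lb Lcb cs !andbT; order_lia.
    have Lcc : right_of s c.-1 c by apply: right_of_trans Lcb Lb.
    have Nc : ~~ right_of s c c.-1 by apply: NL => //; order_lia.
    have ec : c.-1.+1 = c by order_lia.
    split; last by apply/negP => /and4P[_ _]; rewrite ec (negPf Nc).
    move=> i /andP[ai ic]; case: (eqVneq i c.-1) => i1.
      by rewrite /black_word i1 ec (negPf Nc).
    case: (eqVneq i b) => ib; first by rewrite /black_word ib rb andbF.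
    have Lba : right_of s a b by case/orP: ab => // /eqP ?; order_lia.
    have /(IH b bc) IHb : a < b by order_lia.
    case: (proj1 (IHb _) Lba) => [|Hb _]; first by order_lia.
    by apply: Hb; order_lia.
- case=> Hb Hr.
  have ec : c.-1.+1 = c by order_lia.
  have Lcc : right_of s c.-1 c.
    have := Hb c.-1; rewrite /black_word Hr andbT ec => Hb1.
    by rewrite -right_ofN ?Hb1 ?ms //; order_lia.
  case: (eqVneq a c.-1) => [->//|ac1].
  case: (boolP (rect_word s (c - 2))) => [r2|r2]; last first.
    apply: right_of_trans Lcc _; apply/(IH c.-1); try order_lia; split.
      by move=> i ?; apply: Hb; order_lia.
    by have <- : c - 2 = c.-1.-1 by order_lia.
  case/and4P: (r2) => _ _; have -> : (c - 2).+1 = c.-1 by order_lia.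
  rewrite ec.
  move=> h1 h2; case: (eqVneq a (c - 2)) => [->//|ac2].
  apply: right_of_trans h2 _; apply/(IH (c - 2)); try order_lia; split.
    by move=> i ?; apply: Hb; order_lia.
  apply/negP => /rect_word_disjoint.
  have -> : (c - 2).-1.+1 = c - 2 by order_lia.
  by rewrite r2.
Qed.

(** * Words with the same relative order *)

Lemma sorted_right_of s : uniq s -> sorted (fun a b => right_of s b a) s.
Proof.
move=> Us; apply/(sortedP 0) => i si.
by rewrite /right_of !index_uniq // ltnW.
Qed.

(** Two words with the same distinct letters are equal when they order these letters
    in the same way, as both are sorted for that order. *)
Lemma filter_right_ofP (P : pred nat) s t : uniq s -> uniq t ->
  filter P s =i t ->
  filter P s = t <-> {in t &, forall a b, right_of s b a = right_of t b a}.
Proof.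
move=> Us Ut st.
have tr w : transitive (fun a b => right_of w b a).
  by move=> ? ? ?; apply: ltn_trans.
have Sf : sorted (fun a b => right_of s b a) (filter P s).
  by apply: sorted_filter (tr s) _ _ (sorted_right_of Us).
split=> [eq_st a b ta tb|agree].
- rewrite eq_st in Sf.
  have sub := sorted_ltn_index (tr s) Sf.
  apply/idP/idP => [|/sub->//].
  case: (eqVneq a b) => [->|ab]; first by rewrite !right_of_irr.
  apply: contraTT; rewrite right_ofN // => /sub-/(_ tb ta) /= Lba.
  rewrite right_ofN //.
  by rewrite -eq_st mem_filter in ta; case/andP: ta.
- apply: (irr_sorted_eq (tr t)) (st) => //.
  + by move=> a; apply: right_of_irr.
  + apply: (@sub_in_sorted _ (mem t)) Sf; first by move=> a b ta tb /=; rewrite agree.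
    by apply/allP => a; rewrite st.
  + exact: sorted_right_of.
Qed.

(** * Inserting the largest value *)

Lemma index_insert (m : nat) (u v : seq nat) (a : nat) : a != m ->
  index a (u ++ m :: v) = index a (u ++ v) + (size u <= index a (u ++ v)).
Proof.
move=> am; rewrite !index_cat /= eq_sym (negPf am).
case: ifP => [|_]; last by rewrite leq_addr addnS addn1.
by rewrite -index_mem [size u <= _]leqNgt => ->; rewrite addn0.
Qed.

Lemma right_of_insert (m : nat) (u v : seq nat) (a b : nat) : a != m -> b != m ->
  right_of (u ++ m :: v) b a = right_of (u ++ v) b a.
Proof.
move=> am bm; rewrite /right_of !index_insert //.
case: (leqP (size u) (index a _)); case: (leqP (size u) (index b _)) => *;
  by rewrite ?addn0 ?addn1; order_lia.
Qed.

Section Insert.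
Variables (u v : seq nat).
Let n := size (u ++ v).
Let m := n.+1.
Let s := u ++ v.
Let s' := u ++ m :: v.
Hypothesis Ws : perm_word s.

Let size_s' : size s' = m.
Proof. by rewrite /s' size_cat /= addnS -size_cat. Qed.

Let neq_m a : a <= n -> a != m.
Proof. by rewrite /m; order_lia. Qed.

Lemma perm_word_insert : perm_word s'.
Proof.
rewrite /perm_word size_s' /m -[n.+1]addn1 iotaD add1n -/m cats1.
rewrite perm_sym perm_rcons perm_sym (perm_catCA u [:: m] v) perm_cons.
exact: Ws.
Qed.

Lemma index_insert_max : index m s' = size u.
Proof.
apply: index_pivot; apply/negP => um.
have := mem_perm_word m Ws; by rewrite mem_cat um /m /n ltnn.
Qed.

Lemma rect_word_insert i : i.+2 <= n -> rect_word s' i = rect_word s i.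
Proof.
move=> i2n; rewrite /rect_word size_s' -/n i2n.
have -> : i.+2 <= m by apply: leqW.
by rewrite !right_of_insert //; try apply: neq_m; order_lia.
Qed.

(** The tile at i only compares values up to i+2, so a new largest value n+1 can
    change it only from i = n-1 on. *)
Lemma tile_word_insert i : i.+2 <= n -> tile_word s' i = tile_word s i.
Proof.
move=> i2n; rewrite /tile_word !rect_word_insert //; last order_lia.
by rewrite right_of_insert //; try apply: neq_m; order_lia.
Qed.

(** At i = n-1 the only possible change is a new rectangle. *)
Lemma tile_word_insert_pred i : i.+1 = n -> ~~ rect_word s' i ->
  tile_word s' i = tile_word s i.
Proof.
move=> i1n r'i; rewrite /tile_word (negPf r'i).
have -> : rect_word s i = false by rewrite /rect_word -/n -i1n ltnn andbF.
case: i => [|i] in i1n r'i *.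
  by rewrite right_of_insert //; try apply: neq_m; order_lia.
by rewrite rect_word_insert ?right_of_insert //; try apply: neq_m; order_lia.
Qed.

(** The value m follows a smaller one or stands first, so that only the step down
    from m can break the condition. *)
Lemma pell_word_insert : pell_word s ->
  (if v is b :: _ then (m <= b + 2) && ((m == b + 2) ==> right_of s b.+1 b)
   else true) -> pell_word s'.
Proof.
move=> Ps Hv; rewrite /pell_word.
have le_n a : a \in s -> a <= n by rewrite mem_perm_word // => /andP[].
have sub : {in s &, subrel (pell_rel s) (pell_rel s')}.
  move=> a b sa sb /andP[ab /implyP Lb]; rewrite /pell_rel ab /=; apply/implyP => eab.
  have := le_n _ sa; have := le_n _ sb => *.
  rewrite right_of_insert ?Lb //; try apply: neq_m; order_lia.
have Ps' : sorted (pell_rel s') s by apply: (sub_in_sorted sub) Ps; apply/allP.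
have rel_m b : b \in s -> m <= b + 2 ->
    (m == b + 2) ==> right_of s b.+1 b -> pell_rel s' m b.
  move=> /le_n bn mb /implyP Lb; rewrite /pell_rel mb /=; apply/implyP => eq_m.
  rewrite right_of_insert ?Lb //; apply: neq_m; order_lia.
have Sv : path (pell_rel s') m v.
  have sub_v : {subset v <= s} by move=> b vb; rewrite mem_cat vb orbT.
  have := drop_sorted (size u) Ps'; rewrite drop_size_cat //.
  move: (pell_rel s') rel_m Hv sub_v => R; case: (v) => //= b w Rm /andP[mb Lb] sub_v ->.
  by rewrite Rm // sub_v ?mem_head.
have lt_m a : a \in u -> pell_rel s' a m.
  move=> ua; have : a <= n by apply: le_n; rewrite mem_cat ua.
  rewrite /pell_rel /m => ?; order_lia.
have := take_sorted (size u) Ps'; rewrite take_size_cat //.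
move: (pell_rel s') Sv lt_m => R Sv; rewrite /s'; case: (u) => //= h w lt_m Pw.
rewrite cat_path Pw /= Sv andbT; apply: lt_m; exact: mem_last.
Qed.
End Insert.

(** * Tiles by position, and existence of Pell words *)

(** The second half of a rectangle is recorded as [None]: the list has one entry per
    position, hence turns concatenation of sashes into concatenation of lists. *)
Definition expand (S : seq tile) : seq (option tile) :=
  flatten [seq if t is Rect then [:: Some Rect; None] else [:: Some t] | t <- S].

Lemma expand_cat S T : expand (S ++ T) = expand S ++ expand T.
Proof. by rewrite /expand map_cat flatten_cat. Qed.

Lemma size_expand S : size (expand S) = word_length S.
Proof. by elim: S => //= -[] S; rewrite /expand /= => ->. Qed.

Lemma expandK : cancel expand (pmap id).
Proof. by elim=> //= -[] S; rewrite /expand /= => ->. Qed.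

Lemma word_length_cat S T : word_length (S ++ T) = word_length S + word_length T.
Proof. by rewrite -!size_expand expand_cat size_cat. Qed.

(** Positions start at 1; the entry added in front makes them list indices. *)
Definition tile_pos (S : seq tile) (i : nat) : option tile :=
  nth None (None :: expand S) i.

Definition sash_word (s : seq nat) : seq tile :=
  pmap (tile_word s) (iota 1 (size s).-1).

(** A word never has a second half of a rectangle without the first half in front of
    it, because rectangles do not overlap and end within the word. *)
Lemma map_tile_word s :
  [seq tile_word s i | i <- iota 1 (size s).-1] = expand (sash_word s).
Proof.
have gen k : forall m, 0 < m -> m + k = maxn 1 (size s) -> ~~ rect_word s m.-1 ->
    [seq tile_word s i | i <- iota m k] = expand (pmap (tile_word s) (iota m k)).
  elim/ltn_ind: k => -[//|k] IH m m0 mk rm.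
  have tN i : rect_word s i -> tile_word s i.+1 = None by rewrite /tile_word /= => ->.
  case: (boolP (rect_word s m)) => [r|r]; last first.
    have [t tm nt] : exists2 t, tile_word s m = Some t & t != Rect.
      rewrite /tile_word (negPf rm) (negPf r).
      by case: ifP => _; [exists Black|exists White].
    by rewrite /= tm [in LHS]IH //; [case: (t) nt|order_lia].
  have tm : tile_word s m = Some Rect by apply/eqP; rewrite tile_word_Rect.
  have m2 : m.+2 <= size s by case/and4P: r.
  case: k => [|k] in mk IH *; first by order_lia.
  rewrite /= tm tN //= [in LHS]IH //; try order_lia.
  exact: rect_word_disjoint r.
apply: gen => //; case: (size s) => //; order_lia.
Qed.

Lemma sash_word_tile s S :
  [seq tile_word s i | i <- iota 1 (size s).-1] = expand S -> sash_word s = S.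
Proof. by rewrite map_tile_word => /(can_inj expandK). Qed.

Lemma tile_posE s i : 0 < i -> i < size s -> tile_pos (sash_word s) i = tile_word s i.
Proof.
case: i => // i _ si; rewrite /tile_pos /= -map_tile_word.
rewrite (nth_map 0) ?size_iota; last order_lia.
by rewrite nth_iota ?add1n //; order_lia.
Qed.

Lemma word_length_sash_word s : word_length (sash_word s) = (size s).-1.
Proof. by rewrite -size_expand -map_tile_word size_map size_iota. Qed.

Definition pell_model (S : seq tile) (s : seq nat) : Prop :=
  [/\ perm_word s, pell_word s, size s = (word_length S).+1 & sash_word s = S].

(** All tiles but the last are kept when the insertion creates no rectangle, and the
    last one is decided by the side of n on which n+1 goes. *)
Lemma sash_word_insert u v : let n := size (u ++ v) in let s' := u ++ n.+1 :: v in
  0 < n -> perm_word (u ++ v) -> ~~ rect_word s' n.-1 ->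
  [seq tile_word s' i | i <- iota 1 n] =
  rcons (expand (sash_word (u ++ v)))
        (if right_of s' n.+1 n then Some Black else Some White).
Proof.
move=> n s' n0 Ws r'.
have size_s' : size s' = n.+1 by rewrite size_cat /= addnS -size_cat.
have -> : iota 1 n = rcons (iota 1 n.-1) n.
  by rewrite -{1}(prednK n0) -[n.-1.+1]addn1 iotaD cats1; congr rcons; order_lia.
rewrite map_rcons /tile_word (negPf r').
have -> : rect_word s' n = false by rewrite /rect_word size_s' ltnn andbF.
congr rcons; rewrite -map_tile_word; apply/eq_in_map => i; rewrite mem_iota => Hi.
case: (eqVneq i n.-1) => [i1|i1].
- by apply: tile_word_insert_pred => //; [rewrite i1 prednK|rewrite i1].
- apply: tile_word_insert => //; rewrite -/n; order_lia.
Qed.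

Lemma pell_model_Black S s : pell_model S s ->
  pell_model (rcons S Black) (rcons s (size s).+1).
Proof.
case=> Ws Ps Ss <-.
have n0 : 0 < size s by rewrite Ss.
have I1 := @perm_word_insert s [::]; have I2 := @pell_word_insert s [::].
have I3 := @sash_word_insert s [::]; have I4 := @index_insert_max s [::].
rewrite cats0 /= in I1 I2 I3 I4.
rewrite -(cats1 s); set s' := s ++ _ in I1 I2 I3 I4 *.
have gt_m a : 0 < a <= size s -> right_of s' (size s).+1 a.
  by rewrite /right_of I4 // -mem_perm_word // index_cat => sa; rewrite sa index_mem.
split.
- exact: I1.
- exact: I2.
- by rewrite -cats1 size_cat word_length_cat word_length_sash_word /= /word_length /=; order_lia.
- apply: sash_word_tile; rewrite size_cat addn1 /= I3 //.
    by rewrite gt_m ?n0 //= -!cats1 expand_cat.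
  apply/negP => /and4P[k0 _ _]; rewrite prednK // => h.
  have := gt_m (size s).-1; rewrite k0 leq_pred => /(_ isT) h'.
  by have := right_of_trans h h'; rewrite right_of_irr.
Qed.

(** The value n+1 goes immediately before n, where no value fits between them: if n-1
    is to the left of n, it is also to the left of n+1. *)
Lemma pell_model_White S s : pell_model S s -> exists s', pell_model (rcons S White) s'.
Proof.
case=> Ws Ps Ss Ts.
have n0 : 0 < size s by rewrite Ss.
have sn : size s \in s by rewrite mem_perm_word // n0 /=.
case/splitPr def_s : {1}s / sn => [u v].
have I1 := @perm_word_insert u (size s :: v).
have I2 := @pell_word_insert u (size s :: v).
have I3 := @sash_word_insert u (size s :: v).
have I4 := @index_insert_max u (size s :: v).
rewrite /= -def_s in I1 I2 I3 I4.
set s' := u ++ _ in I1 I2 I3 I4; exists s'.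
have Un : size s \notin u.
  move: (perm_word_uniq Ws); rewrite {1}def_s cat_uniq /= negb_or.
  by case/and3P=> _ /andP[].
have In : index (size s) s' = (size u).+1.
  by rewrite index_cat (negPf Un) /= eqxx -[_ == _]/((size s).+1 == size s) gtn_eqF // addn1.
have sz : size s' = (size s).+1.
  by have := congr1 size def_s; rewrite /s' !size_cat /=; order_lia.
rewrite -Ts; split.
- exact: I1.
- by apply: I2 => //; rewrite addn2 leqnSn /= ltn_eqF.
- by rewrite sz -cats1 word_length_cat word_length_sash_word /word_length /=; order_lia.
- apply: sash_word_tile.
  rewrite sz /= I3 //.
    by rewrite -!cats1 expand_cat /right_of In I4 // ltnNge leqnSn.
  apply/negP => /and4P[k0 _]; rewrite prednK // /right_of In I4 // ltnS leqNgt.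
  by move=> /negPf->.
Qed.

(** First n+1 goes to the end, which puts n+1 to the right of n; then n+2 goes
    immediately before n, a step down by 2 that is allowed since n+1 is to the
    right of n. *)
Lemma pell_model_Rect S s : pell_model S s -> exists s', pell_model (rcons S Rect) s'.
Proof.
move=> Ms; have [n Ss] : exists n, size s = n by exists (size s).
have := pell_model_Black Ms; case: (Ms) => Ws _ Sn _.
have n0 : 0 < n by rewrite -Ss Sn.
have sn : n \in s by rewrite mem_perm_word // Ss n0 leqnn.
set t := rcons s _.
case/splitPr def_s : {1}s / sn => [u v] [Wt Pt St Tt].
have def_t : t = u ++ n :: rcons v n.+1 by rewrite /t Ss {1}def_s rcons_cat.
have St1 : size t = n.+1 by rewrite size_rcons Ss.
have I1 := @perm_word_insert u (n :: rcons v n.+1).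
have I2 := @pell_word_insert u (n :: rcons v n.+1).
have I3 := @sash_word_insert u (n :: rcons v n.+1).
have I4 := @index_insert_max u (n :: rcons v n.+1).
have I5 := @tile_word_insert u (n :: rcons v n.+1).
rewrite /= -def_t St1 in I1 I2 I3 I4 I5.
set s' := u ++ _ in I1 I2 I3 I4 I5.
have Un : n \notin u.
  move: (perm_word_uniq Ws); rewrite {1}def_s cat_uniq /= negb_or.
  by case/and3P=> _ /andP[].
have last_n a : a \in s -> right_of t n.+1 a.
  have Nn : n.+1 \notin s by rewrite mem_perm_word // Ss ltnn.
  move=> sa; rewrite /right_of /t -cats1 !index_cat sa (negPf Nn) Ss /= eqxx addn0.
  by rewrite -Ss index_mem.
have sn : n \in s by rewrite mem_perm_word // Ss n0 leqnn.
have In : index n s' = (size u).+1.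
  by rewrite index_cat (negPf Un) /= eqxx -[_ == _]/(n.+2 == n) gtn_eqF ?addn1.
have Im := I4 Wt.
have sz : size s' = n.+2.
  by have := congr1 size def_t; rewrite St1 /s' !size_cat /=; order_lia.
have rn : rect_word s' n.
  rewrite /rect_word n0 sz leqnn {2}/right_of In Im leqnn andbT.
  by rewrite right_of_insert -?def_t ?last_n //; order_lia.
have rp : ~~ rect_word s' n.-1.
  apply/negP => /and4P[k0 _ _]; rewrite prednK //.
  rewrite right_of_insert -?def_t; try order_lia.
  move=> h; have sp : n.-1 \in s by rewrite mem_perm_word // Ss; order_lia.
  by have := right_of_trans h (last_n _ sp); rewrite right_of_irr.
exists s'; split.
- exact: I1.
- by apply: I2 => //; rewrite addn2 leqnn eqxx last_n.
- by rewrite sz -cats1 word_length_cat /word_length /= -/(word_length S); order_lia.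
- apply: sash_word_tile; rewrite sz -[n.+2.-1]/(n.+1) -cats1 expand_cat.
  have := map_tile_word t; rewrite St1 Tt -cats1 expand_cat -[n.+1.-1]/n.
  have iotaE : iota 1 n = rcons (iota 1 n.-1) n.
    by rewrite -{1}(prednK n0) -[n.-1.+1]addn1 iotaD cats1; congr rcons; order_lia.
  rewrite iotaE map_rcons -cats1 => /eqP.
  rewrite eqseq_cat ?size_map ?size_iota ?size_expand; last order_lia.
  case/andP=> /eqP <- _.
  have -> : iota 1 n.+1 = iota 1 n.-1 ++ [:: n; n.+1].
    rewrite -[n.+1]addn1 iotaD iotaE -cats1 -catA /=; congr (_ ++ [:: _; _]); order_lia.
  rewrite map_cat; congr (_ ++ _).
    by apply/eq_in_map => i; rewrite mem_iota => Hi; apply: I5 => //; order_lia.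
  by rewrite /= {2}/tile_word rn /tile_word (negPf rp) rn.
Qed.

Lemma pell_model_exists S : exists s, pell_model S s.
Proof.
elim/last_ind: S => [|S t [s Ms]]; first by exists [:: 1].
case: t.
- by exists (rcons s (size s).+1); apply: pell_model_Black.
- exact: pell_model_White Ms.
- exact: pell_model_Rect Ms.
Qed.

(** * Inversions in terms of sashes *)

Lemma tile_pos_catl S T i : i <= word_length S -> tile_pos (S ++ T) i = tile_pos S i.
Proof.
case: i => // i iS; rewrite /tile_pos /= expand_cat nth_cat size_expand iS //.
Qed.

Lemma tile_pos_catr S T i : 0 < i -> tile_pos (S ++ T) (i + word_length S) = tile_pos T i.
Proof.
case: i => // i _; rewrite /tile_pos /= expand_cat nth_cat size_expand.
by rewrite ltnNge leq_addl addnK.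
Qed.

(** The inversions (c, a) of the Pell permutation of S. *)
Definition sash_inv (S : seq tile) (a c : nat) : Prop :=
  (forall i, a <= i < c -> tile_pos S i <> Some Black) /\
  tile_pos S c.-1 <> Some Rect.

Lemma tile_pos_Black S s i : pell_model S s -> 0 < i -> i < size s ->
  (tile_pos S i == Some Black) = black_word s i.
Proof. by case=> _ _ _ <- i0 si; rewrite tile_posE ?tile_word_Black. Qed.

Lemma tile_pos_Rect S s i : pell_model S s -> 0 < i -> i < size s ->
  (tile_pos S i == Some Rect) = rect_word s i.
Proof. by case=> _ _ _ <- i0 si; rewrite tile_posE ?tile_word_Rect. Qed.

Lemma right_of_sash_inv S s a c : pell_model S s ->
  0 < a -> a < c -> c <= size s -> right_of s a c <-> sash_inv S a c.
Proof.
move=> Ms a0 ac cs; case: (Ms) => Ws Ps _ _; rewrite pell_right_of //.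
split=> -[Hb Hr]; split.
- by move=> i Hi; apply/eqP; rewrite (tile_pos_Black Ms) ?Hb //; order_lia.
- by apply/eqP; rewrite (tile_pos_Rect Ms) //; order_lia.
- by move=> i Hi; rewrite -(tile_pos_Black Ms); [apply/eqP/Hb|order_lia|order_lia].
- by rewrite -(tile_pos_Rect Ms); [apply/eqP|order_lia|order_lia].
Qed.

(** Comparing increasing pairs is enough, since a word orders its letters totally. *)
Lemma right_of_ext k s t f : perm_word s -> perm_word t ->
  k <= size s -> k + f <= size t ->
  (forall a c, 0 < a -> a < c -> c <= k -> right_of t (a + f) (c + f) = right_of s a c) ->
  forall a c, 0 < a <= k -> 0 < c <= k -> right_of t (a + f) (c + f) = right_of s a c.
Proof.
move=> Ws Wt ks kt H a c Ha Hc; case: (ltngtP a c) => [ac|ca|->].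
- by apply: H; order_lia.
- have ta : a + f \in t by rewrite mem_perm_word //; order_lia.
  have sa : a \in s by rewrite mem_perm_word //; order_lia.
  rewrite -(@right_ofN t (a + f) (c + f)) // ?eqn_add2r ?gtn_eqF //.
  by rewrite -(@right_ofN s a c) // ?gtn_eqF // H //; order_lia.
- by rewrite !right_of_irr.
Qed.

Lemma perm_word_inj s t : perm_word s -> perm_word t -> size s = size t ->
  (forall a c, 0 < a -> a < c -> c <= size s -> right_of t a c = right_of s a c) ->
  s = t.
Proof.
move=> Ws Wt st H.
have st_mem : filter predT s =i t by move=> a; rewrite filter_predT !mem_perm_word // st.
rewrite -[LHS]filter_predT; apply/filter_right_ofP; rewrite ?perm_word_uniq //.
move=> a b; rewrite !mem_perm_word // -st => Ha Hb.
rewrite -[in RHS](addn0 a) -[in RHS](addn0 b).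
by rewrite (@right_of_ext (size s) s t 0) ?addn0 -?st // => c d *; rewrite !addn0 H.
Qed.

Lemma pell_model_inj S s t : pell_model S s -> pell_model S t -> s = t.
Proof.
move=> Ms Mt; case: (Ms) (Mt) => Ws _ ss _ [Wt _ st _].
have est : size s = size t by rewrite ss st.
apply: perm_word_inj => // a c a0 ac cs.
by apply/idP/idP; rewrite !(right_of_sash_inv Ms, right_of_sash_inv Mt) -?est.
Qed.

(** * Shifted shuffles as agreement of orders *)

Section Shuffle.
Variables (p q : nat) (x y z : seq nat).
Hypotheses (sx : size x = p) (sy : size y = q) (sz : size z = p + q).

Definition agree_low := forall a c, 0 < a -> a < c -> c <= p ->
  right_of z a c = right_of x a c.

Definition agree_high := forall a c, 0 < a -> a < c -> c <= q ->
  right_of z (a + p) (c + p) = right_of y a c.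

Hypotheses (Wx : perm_word x) (Wy : perm_word y) (Wz : perm_word z).

Lemma agree_lowE : agree_low ->
  forall a c, 0 < a <= p -> 0 < c <= p -> right_of z a c = right_of x a c.
Proof.
move=> Hl a c Ha Hc; rewrite -(addn0 a) -(addn0 c).
rewrite (@right_of_ext p x z 0) ?addn0 ?sx ?sz ?leq_addr //.
by move=> b d *; rewrite !addn0 Hl.
Qed.

Lemma agree_highE : agree_high ->
  forall a c, 0 < a <= q -> 0 < c <= q -> right_of z (a + p) (c + p) = right_of y a c.
Proof.
by move=> Hh a c Ha Hc; rewrite (@right_of_ext q y z p) ?sy ?sz // addnC.
Qed.

Lemma shuffle_agree :
  ([seq v <- z | v <= p] == x) && ([seq v <- z | p < v] == [seq v + p | v <- y]) <->
  agree_low /\ agree_high.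
Proof.
have Uz := perm_word_uniq Wz; have Ux := perm_word_uniq Wx.
have Uy : uniq [seq v + p | v <- y].
  by rewrite (map_inj_uniq (@addIn p)) perm_word_uniq.
have mx v : (v \in x) = (0 < v <= p) by rewrite mem_perm_word ?sx.
have my v : (v \in y) = (0 < v <= q) by rewrite mem_perm_word ?sy.
have mz v : (v \in z) = (0 < v <= p + q) by rewrite mem_perm_word ?sz.
have low : [seq v <- z | v <= p] =i x.
  by move=> v; rewrite mem_filter mx mz; order_lia.
have high : [seq v <- z | p < v] =i [seq v + p | v <- y].
  move=> v; rewrite mem_filter mz.
  apply/idP/mapP => [Hv|[w + ->]]; last by rewrite my; order_lia.
  by exists (v - p); rewrite ?my; order_lia.
have Eq v w : right_of [seq v + p | v <- y] (v + p) (w + p) = right_of y v w.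
  by rewrite /right_of !(index_map (@addIn p)).
have {low} low := filter_right_ofP Uz Ux low.
have {high} high := filter_right_ofP Uz Uy high.
split=> [/andP[/eqP/low Hl /eqP/high Hh]|[Hl Hh]].
- split=> a c a0 ac cp.
    by apply: Hl; rewrite mx; order_lia.
  by rewrite Hh ?Eq // (map_f (addn^~ p)) // my; order_lia.
- apply/andP; split; apply/eqP.
  + by apply/low => a c; rewrite !mx => *; apply: agree_lowE.
  + apply/high => _ _ /mapP[a + ->] /mapP[c + ->].
    by rewrite Eq !my => *; apply: agree_highE.
Qed.
End Shuffle.

(** * Pell shuffles form an interval *)

Lemma pair_cases p q a c : 0 < a -> a < c -> c <= p + q ->
  [\/ c <= p, a <= p /\ p < c |
     exists a' c', [/\ a = a' + p, c = c' + p, 0 < a', a' < c' & c' <= q]].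
Proof.
move=> a0 ac cn; case: (leqP c p) => [|pc]; first by constructor 1.
case: (leqP a p) => [|pa]; first by constructor 2.
by constructor 3; exists (a - p), (c - p); split; order_lia.
Qed.

Lemma sash_inv_eq S T a c : 0 < a -> a < c ->
  (forall i, 0 < i -> i < c -> tile_pos S i = tile_pos T i) ->
  sash_inv S a c <-> sash_inv T a c.
Proof.
move=> a0 ac E; rewrite /sash_inv E; try order_lia.
by split=> -[Hb Hr]; split=> // i Hi; move: (Hb i Hi); rewrite E //; order_lia.
Qed.

Lemma sash_inv_catl S T a c : 0 < a -> a < c -> c <= (word_length S).+1 ->
  sash_inv (S ++ T) a c <-> sash_inv S a c.
Proof.
move=> a0 ac cS; apply: sash_inv_eq => // i i0 ic; apply: tile_pos_catl; order_lia.
Qed.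

Lemma sash_inv_catr S T p a c : word_length S = p -> 0 < a -> a < c ->
  sash_inv (S ++ T) (a + p) (c + p) <-> sash_inv T a c.
Proof.
move=> lenS a0 ac; have E i : 0 < i -> tile_pos (S ++ T) (i + p) = tile_pos T i.
  by rewrite -lenS; apply: tile_pos_catr.
have c1 : (c + p).-1 = c.-1 + p by order_lia.
rewrite /sash_inv c1 E; last order_lia.
split=> -[Hb Hr]; split=> // i Hi.
  by move: (Hb (i + p)); rewrite E; [apply; order_lia|order_lia].
have -> : i = (i - p) + p by order_lia.
by rewrite E; [apply: Hb; order_lia|order_lia].
Qed.

(** The properties that A' r (for A = A' b) and A w (for other A) share, and that
    make F B an upper end: F has no black square at its last two positions, so it
    does not block inversions between low and high values there, but has the same
    inversions among low values as A. For these, a rectangle at the last position m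
    of A replaces a black square harmlessly: each of them excludes exactly the
    inversions (c, a) with c = m+1. *)
Definition upper_end (A F : seq tile) (m := word_length A) : Prop :=
  [/\ word_length F = m.+1,
      forall i, 0 < i -> i < m -> tile_pos F i = tile_pos A i,
      tile_pos F m = tile_pos A m \/
        tile_pos F m = Some Rect /\ tile_pos A m = Some Black,
      tile_pos F m <> Some Black &
      tile_pos F m.+1 <> Some Black /\ tile_pos F m.+1 <> Some Rect].

Lemma upper_end_White A :
  (forall A', A <> A' ++ [:: Black]) -> upper_end A (A ++ [:: White]).
Proof.
move=> nB; set F := A ++ _.
have EF i : i <= word_length A -> tile_pos F i = tile_pos A i by exact: tile_pos_catl.
have F_last : tile_pos F (word_length A).+1 = Some White by rewrite -add1n tile_pos_catr.
rewrite /upper_end F_last.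
split=> //; first by rewrite word_length_cat /word_length /= addn1.
- by move=> i i0 iA; apply: EF; rewrite ltnW.
- by left; apply: EF.
rewrite EF //; case: (lastP A) nB => [//|A' t] nB; rewrite -cats1 word_length_cat.
case: t nB => nB; rewrite /word_length /= ?[_ + 0]addn0; last 2 first.
- by rewrite addnC tile_pos_catr.
- by rewrite addn2 -add2n tile_pos_catr.
by case: (nB A'); rewrite cats1.
Qed.

Lemma upper_end_Rect A' : upper_end (A' ++ [:: Black]) (A' ++ [:: Rect]).
Proof.
have lenA : word_length (A' ++ [:: Black]) = (word_length A').+1.
  by rewrite word_length_cat addn1.
rewrite /upper_end lenA.
have -> : tile_pos (A' ++ [:: Rect]) (word_length A').+1 = Some Rect.
  by rewrite -add1n tile_pos_catr.
have -> : tile_pos (A' ++ [:: Black]) (word_length A').+1 = Some Black.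
  by rewrite -add1n tile_pos_catr.
have -> : tile_pos (A' ++ [:: Rect]) (word_length A').+2 = None.
  by rewrite -add2n tile_pos_catr.
split=> //; [by rewrite word_length_cat addn2|move=> i i0 iA|by right].
by rewrite !tile_pos_catl.
Qed.

Section Interval.
Variables (p q : nat) (x y z : seq nat) (A B C F : seq tile).
Hypotheses (Mx : pell_model A x) (My : pell_model B y) (Mz : pell_model C z).
Hypotheses (sx : size x = p) (sy : size y = q) (sz : size z = p + q).
Hypothesis AF : upper_end A F.

Let lenA : (word_length A).+1 = p.
Proof. by case: Mx => _ _ <-. Qed.

Let lenB : (word_length B).+1 = q.
Proof. by case: My => _ _ <-. Qed.

Let lenF : word_length F = p.
Proof. by rewrite -lenA; case: AF. Qed.

Let F_lt i : 0 < i -> i.+1 < p -> tile_pos F i = tile_pos A i.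
Proof. by rewrite -lenA; case: AF => _ + _ _ _; apply. Qed.

Let F_pred : tile_pos F p.-1 = tile_pos A p.-1 \/
  tile_pos F p.-1 = Some Rect /\ tile_pos A p.-1 = Some Black.
Proof. by rewrite -lenA; case: AF. Qed.

Let F_pred_Black : tile_pos F p.-1 <> Some Black.
Proof. by rewrite -lenA; case: AF. Qed.

Let F_last : tile_pos F p <> Some Black /\ tile_pos F p <> Some Rect.
Proof. by rewrite -lenA; case: AF. Qed.

(** When a rectangle replaces the last black square of A, the case c = p holds since
    neither side has an inversion there. *)
Lemma sash_inv_low a c : 0 < a -> a < c -> c <= p ->
  sash_inv (F ++ B) a c <-> sash_inv A a c.
Proof.
move=> a0 ac cp; rewrite sash_inv_catl //; last by rewrite lenF leqW.
case: F_pred => [Fp|[FR AB]].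
  apply: sash_inv_eq => // i i0 ic.
  by case: (eqVneq i p.-1) => [->//|ne]; apply: F_lt => //; order_lia.
case: (ltnP c p) => [cp'|pc].
  by apply: sash_inv_eq => // i i0 ic; apply: F_lt => //; apply: leq_ltn_trans cp'.
have -> : c = p by apply/eqP; rewrite eqn_leq cp.
split=> -[Hb Hr]; first by case: Hr.
by case: (Hb p.-1) => //; order_lia.
Qed.

Section Cross.
Hypotheses (Hl : agree_low p x z) (Hh : agree_high p q y z).

Let Hl' a c : 0 < a <= p -> 0 < c <= p -> right_of z a c = right_of x a c.
Proof. by case: Mx Mz => Wx _ _ _ [Wz _ _ _]; apply: (agree_lowE sx sz). Qed.

Let Hh' a c : 0 < a <= q -> 0 < c <= q ->
  right_of z (a + p) (c + p) = right_of y a c.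
Proof. by case: My Mz => Wy _ _ _ [Wz _ _ _]; apply: (agree_highE sy sz). Qed.

(** The tile at i depends on the values i, i+1, i+2 alone. For i = p-1 these are not
    all low, and z may have a rectangle where x has a black square. *)
Lemma black_low i : 0 < i -> i.+1 < p -> black_word x i = black_word z i.
Proof.
move=> i0 ip; rewrite /black_word /rect_word sx sz i0 ip.
have -> : i.+2 <= p + q by apply: leq_trans ip (leq_addr _ _).
by rewrite !Hl' // ?i0 ?ip ?(ltnW ip) ?(ltnW (ltnW ip)).
Qed.

Lemma rect_high i : 0 < i -> rect_word z (i + p) = rect_word y i.
Proof.
move=> i0; rewrite /rect_word i0 sy sz addn_gt0 i0 -!addSn [_ + q]addnC leq_add2r /=.
case: (leqP i.+2 q) => //= iq.
by rewrite !Hh' // ?i0 ?iq ?(ltnW iq) ?(ltnW (ltnW iq)).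
Qed.

Lemma black_high i : 0 < i -> i < q -> black_word z (i + p) = black_word y i.
Proof.
by move=> i0 iq; rewrite /black_word rect_high // -addSn Hh' // ?iq ?i0 ?(ltnW iq).
Qed.

(** A black square of F B at one of a, ..., c-1, or a rectangle at c-1, would sit
    at a position below p-1 or above p; there the orders of x and y, which z
    shares, force the same tile on z. *)
Lemma sash_inv_cross a c : 0 < a -> a <= p -> p < c -> c <= p + q ->
  right_of z a c -> sash_inv (F ++ B) a c.
Proof.
move=> a0 ap pc cpq; have [Wz Pz _ _] := Mz.
have ac : a < c by apply: leq_ltn_trans pc.
rewrite (pell_right_of Wz Pz) ?sz //; case=> Hb Hr {Wz Pz}; split.
  move=> i /andP[ai ic]; have i0 : 0 < i by apply: leq_trans ai.
  have nb : ~~ black_word z i by rewrite Hb ?ai.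
  case: (ltngtP i p) => [ip|pi|->]; last by rewrite tile_pos_catl ?lenF //; case: F_last.
    rewrite tile_pos_catl ?lenF 1?ltnW //; case: (ltnP i.+1 p) => ip'.
      by rewrite F_lt //; apply/eqP; rewrite (tile_pos_Black Mx) ?sx // black_low.
    by have -> : i = p.-1 by rewrite -(prednK (leq_trans i0 (ltnW ip))); order_lia.
  have [j ei j0] : exists2 j, i = j + p & 0 < j by exists (i - p); order_lia.
  rewrite ei -lenF tile_pos_catr //; apply/eqP.
  have jq : j < q by order_lia.
  by rewrite (tile_pos_Black My) ?sy // -black_high // -ei.
case: (eqVneq c.-1 p) => [->|cp]; first by rewrite tile_pos_catl ?lenF //; case: F_last.
have [j ei j0] : exists2 j, c.-1 = j + p & 0 < j by exists (c.-1 - p); order_lia.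
rewrite ei -lenF tile_pos_catr //; apply/eqP.
have jq : j < q by order_lia.
by rewrite (tile_pos_Rect My) ?sy // -rect_high // -ei.
Qed.
End Cross.

Variables (d e : seq nat).
Hypotheses (Md : pell_model (A ++ Black :: B) d) (Me : pell_model (F ++ B) e).

(** In A b B the black square at p excludes every inversion between a low and a high
    value, so the lower bound holds as soon as the orders agree. *)
Lemma agree_interval : agree_low p x z /\ agree_high p q y z <->
  (forall a c, 0 < a -> a < c -> c <= p + q -> right_of d a c -> right_of z a c) /\
  (forall a c, 0 < a -> a < c -> c <= p + q -> right_of z a c -> right_of e a c).
Proof.
have lenAb : word_length (A ++ [:: Black]) = p.
  by rewrite word_length_cat /word_length /= addn1.
have sd : size d = p + q.
  by case: Md => _ _ -> _; rewrite -cat1s catA word_length_cat lenAb -lenB addnS.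
have se : size e = p + q.
  by case: Me => _ _ -> _; rewrite word_length_cat lenF -lenB addnS.
have d_p : tile_pos (A ++ Black :: B) p = Some Black.
  by rewrite -lenA -add1n tile_pos_catr.
have x_inv a c : 0 < a -> a < c -> c <= p -> right_of x a c <-> sash_inv A a c.
  by rewrite -sx; apply: right_of_sash_inv.
have y_inv a c : 0 < a -> a < c -> c <= q -> right_of y a c <-> sash_inv B a c.
  by rewrite -sy; apply: right_of_sash_inv.
have d_inv a c : 0 < a -> a < c -> c <= p + q ->
    right_of d a c <-> sash_inv (A ++ Black :: B) a c.
  by rewrite -sd; apply: right_of_sash_inv.
have e_inv a c : 0 < a -> a < c -> c <= p + q -> right_of e a c <-> sash_inv (F ++ B) a c.
  by rewrite -se; apply: right_of_sash_inv.
have le_q c : c <= p -> c <= p + q by move=> cp; apply: leq_trans (leq_addr _ _).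
have d_low a c : 0 < a -> a < c -> c <= p -> right_of d a c <-> right_of x a c.
  by move=> *; rewrite d_inv ?x_inv ?le_q // sash_inv_catl ?lenA.
have e_low a c : 0 < a -> a < c -> c <= p -> right_of e a c <-> right_of x a c.
  by move=> *; rewrite e_inv ?x_inv ?le_q // sash_inv_low.
have gt0 a : 0 < a -> 0 < a + p by move=> a0; rewrite addn_gt0 a0.
have lt_p a c : a < c -> a + p < c + p by rewrite ltn_add2r.
have le_pq c : c <= q -> c + p <= p + q by move=> cq; rewrite addnC leq_add2l.
have d_high a c : 0 < a -> a < c -> c <= q ->
    right_of d (a + p) (c + p) <-> right_of y a c.
  move=> *; rewrite d_inv ?y_inv ?gt0 ?lt_p ?le_pq //.
  by rewrite -cat1s catA (sash_inv_catr _ lenAb).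
have e_high a c : 0 < a -> a < c -> c <= q ->
    right_of e (a + p) (c + p) <-> right_of y a c.
  by move=> *; rewrite e_inv ?y_inv ?gt0 ?lt_p ?le_pq // (sash_inv_catr _ lenF).
split=> [[Hl Hh]|[Hd He]]; split=> a c a0 ac cn.
- case: (pair_cases a0 ac cn) => [cp|[ap pc]|[a' [c' [-> -> ? ? ?]]]].
  + by rewrite Hl // d_low.
  + by rewrite d_inv // => -[Hb _]; case: (Hb p) => //; rewrite ap.
  + by rewrite Hh // d_high.
- case: (pair_cases a0 ac cn) => [cp|[ap pc]|[a' [c' [-> -> ? ? ?]]]].
  + by rewrite Hl // e_low.
  + by rewrite e_inv //; apply: sash_inv_cross.
  + by rewrite Hh // e_high.
- have [[_ x_d] [e_x _]] := (d_low _ _ a0 ac cn, e_low _ _ a0 ac cn).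
  have d_z := Hd _ _ a0 ac (le_q _ cn); have z_e := He _ _ a0 ac (le_q _ cn).
  by apply/idP/idP => [/z_e/e_x|/x_d/d_z].
- have [[_ y_d] [e_y _]] := (d_high _ _ a0 ac cn, e_high _ _ a0 ac cn).
  have d_z := Hd _ _ (gt0 _ a0) (lt_p _ _ ac) (le_pq _ cn).
  have z_e := He _ _ (gt0 _ a0) (lt_p _ _ ac) (le_pq _ cn).
  by apply/idP/idP => [/z_e/e_y|/y_d/d_z].
Qed.
End Interval.

(** * From words to permutations *)

Lemma size_oneline n (x : 'S_n) : size (oneline x) = n.
Proof. by rewrite size_map size_enum_ord. Qed.

Lemma nth_oneline n (x : 'S_n) (i : 'I_n) : nth 0 (oneline x) i = (x i).+1.
Proof. by rewrite (nth_map i) ?size_enum_ord // nth_ord_enum. Qed.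

Lemma oneline_inj n : injective (@oneline n).
Proof.
move=> x y exy; apply/permP => i; apply/val_inj/succn_inj.
by rewrite /= -!nth_oneline exy.
Qed.

Lemma uniq_oneline n (x : 'S_n) : uniq (oneline x).
Proof.
by rewrite map_inj_uniq ?enum_uniq // => i j [] /val_inj/perm_inj.
Qed.

Lemma perm_word_oneline n (x : 'S_n) : perm_word (oneline x).
Proof.
rewrite /perm_word; apply: uniq_perm; rewrite ?uniq_oneline ?iota_uniq //.
move=> v; rewrite mem_iota size_oneline; apply/mapP/idP => [[i _ ->]|Hv].
  by rewrite add1n !ltnS ltn_ord.
have vn : v.-1 < n by order_lia.
exists ((x^-1)%g (Ordinal vn)); rewrite ?mem_enum // permKV /=; order_lia.
Qed.

Lemma oneline_surj s : perm_word s -> exists x : 'S_(size s), oneline x = s.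
Proof.
move=> Ws.
have lt_n (i : 'I_(size s)) : (nth 0 s i).-1 < size s.
  by have := mem_nth 0 (ltn_ord i); rewrite mem_perm_word // => /andP[/prednK->].
have inj : injective (fun i => Ordinal (lt_n i)).
  move=> i j [] eq_ij; apply/val_inj/eqP.
  rewrite -(nth_uniq 0 (ltn_ord i) (ltn_ord j) (perm_word_uniq Ws)).
  have := mem_nth 0 (ltn_ord i); have := mem_nth 0 (ltn_ord j).
  rewrite !mem_perm_word //; move: (nth 0 s i) (nth 0 s j) eq_ij => u v; order_lia.
exists (perm inj); apply: (@eq_from_nth _ 0); rewrite size_oneline // => i si.
rewrite -[i]/(val (Ordinal si)) nth_oneline permE /=.
by have := mem_nth 0 si; rewrite mem_perm_word // => /andP[/prednK->].
Qed.

Lemma pell_oneline n (x : 'S_n) : pell x = pell_word (oneline x).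
Proof.
apply/forallP/(sortedP 0) => [H i|H i].
  rewrite size_oneline => si; have si' : i < n.-1 by order_lia.
  exact: H (Ordinal si').
by apply: H; rewrite size_oneline; have := ltn_ord i; order_lia.
Qed.

Lemma sigma_oneline n (x : 'S_n) : 0 < n -> sigma x = Some (sash_word (oneline x)).
Proof.
case: n x => // n x _; rewrite /sigma /sash_word size_oneline; congr Some.
have rE i : rect_at x i = rect_word (oneline x) i.
  by rewrite /rect_at /rect_word size_oneline !addn1 !addn2.
by apply: eq_pmap => i; rewrite /tile_at /tile_word !rE addn1.
Qed.

Lemma degree_sigma n (x : 'S_n) : degree (sigma x) = n.
Proof.
case: (posnP n) x => [->//|n0] x.
by rewrite sigma_oneline //= word_length_sash_word size_oneline prednK.
Qed.

Lemma S0_eq (x y : 'S_0) : x = y.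
Proof. by apply/permP => -[]. Qed.

Lemma sigma_pell_inj n (x y : 'S_n) : pell x -> pell y -> sigma x = sigma y -> x = y.
Proof.
case: (posnP n) x y => [->|n0] x y; first by move=> *; apply: S0_eq.
rewrite !pell_oneline => Px Py; rewrite !sigma_oneline // => -[] exy.
apply/oneline_inj/(@pell_model_inj (sash_word (oneline y))).
  by split; rewrite ?perm_word_oneline ?word_length_sash_word ?size_oneline ?prednK ?exy.
by split; rewrite ?perm_word_oneline ?word_length_sash_word ?size_oneline ?prednK.
Qed.

Lemma etaP n A : degree A = n -> pell (eta n A) /\ sigma (eta n A) = A.
Proof.
move=> dA; rewrite /eta; case: pickP => [x /andP[Px /eqP]//|none]; exfalso.
suff [x Px sx] : exists2 x : 'S_n, pell x & sigma x = A.
  by have := none x; rewrite Px sx eqxx.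
case: A dA {none} => [S|] /= <-; last first.
  by exists 1%g => //; apply/forallP => -[].
have [s [Ws Ps ss Ts]] := pell_model_exists S.
have [x xs] := oneline_surj Ws; rewrite -ss; exists x; first by rewrite pell_oneline xs.
by rewrite sigma_oneline ?ss // xs Ts.
Qed.

Lemma eta_sigma n (x : 'S_n) : pell x -> eta n (sigma x) = x.
Proof.
move=> Px; have [Pe se] := etaP (degree_sigma x).
exact: sigma_pell_inj se.
Qed.

Lemma mem_inversions n (x : 'S_n) (u v : 'I_n) :
  ((u, v) \in inversions x) = (v < u) && right_of (oneline x) v.+1 u.+1.
Proof.
have idx (i : 'I_n) : index (x i).+1 (oneline x) = i.
  by rewrite -nth_oneline index_uniq ?uniq_oneline ?size_oneline.
apply/imsetP/andP => [[[i j]]|[vu]].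
  by rewrite inE /= => /andP[ij xij] [-> ->]; rewrite /right_of !idx.
rewrite /right_of -{1 2}(permKV x u) -{1 2}(permKV x v) !idx => uv.
by exists ((x^-1)%g u, (x^-1)%g v); rewrite ?inE /= !permKV ?uv.
Qed.

Lemma weak_leP n (x y : 'S_n) :
  weak_le x y <-> (forall a c, 0 < a -> a < c -> c <= n ->
                   right_of (oneline x) a c -> right_of (oneline y) a c).
Proof.
split=> [/subsetP sub a c a0 ac cn|H].
  have an : a.-1 < n by order_lia. have cn' : c.-1 < n by order_lia.
  have := sub (Ordinal cn', Ordinal an); rewrite !mem_inversions /= !prednK //; order_lia.
apply/subsetP => -[u v]; rewrite !mem_inversions => /andP[vu Luv].
by rewrite vu H.
Qed.

Lemma pell_model_oneline n (x : 'S_n) S :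
  pell x -> sigma x = Some S -> pell_model S (oneline x).
Proof.
move=> Px sx; have n0 : 0 < n by case: (n) x Px sx.
move: sx; rewrite sigma_oneline // => -[<-]; split=> //.
- exact: perm_word_oneline.
- by rewrite -pell_oneline.
- by rewrite word_length_sash_word size_oneline prednK.
Qed.

Lemma shuffle_interval p q (A B F : seq tile) (z : 'S_(p + q)) :
  (word_length A).+1 = p -> (word_length B).+1 = q -> upper_end A F ->
  pell z ->
  is_shifted_shuffle (eta p (Some A)) (eta q (Some B)) z =
  sash_le (p + q) (Some (A ++ Black :: B)) (sigma z) &&
  sash_le (p + q) (sigma z) (Some (F ++ B)).
Proof.
move=> lenA lenB AF Pz; have lenF : word_length F = p by rewrite -lenA; case: AF.
have [Px sx] := @etaP p (Some A) lenA.
have [Py sy] := @etaP q (Some B) lenB.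
have dD : degree (Some (A ++ Black :: B)) = p + q.
  by rewrite /= word_length_cat -[word_length (_ :: _)]/(word_length B).+1 lenB -addSn lenA.
have dE : degree (Some (F ++ B)) = p + q.
  by rewrite /= word_length_cat lenF -lenB addnS.
have [Pd sd] := etaP dD; have [Pe se] := etaP dE.
rewrite /sash_le dD dE degree_sigma !eqxx /= eta_sigma //.
have z0 : 0 < p + q by rewrite -lenA.
have Mx := pell_model_oneline Px sx; have My := pell_model_oneline Py sy.
have Mz := pell_model_oneline Pz (sigma_oneline z z0).
have Md := pell_model_oneline Pd sd; have Me := pell_model_oneline Pe se.
have agree_int := agree_interval Mx My Mz (size_oneline _) (size_oneline _)
  (size_oneline _) AF Md Me.
have shuf := shuffle_agree (size_oneline (eta p (Some A)))
  (size_oneline (eta q (Some B))) (size_oneline z) (perm_word_oneline _)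
  (perm_word_oneline _) (perm_word_oneline _).
apply/idP/andP => [/shuf/agree_int[/weak_leP le1 /weak_leP le2] //|[]].
by move=> /weak_leP le1 /weak_leP le2; apply/shuf/agree_int.
Qed.

Local Open Scope ring_scope.

(** * Linear extensions *)

Section Freeg.
Variables (K : fieldType) (T : choiceType) (M : lmodType K) (f : T -> M).

HB.instance Definition _ := GRing.isZmodMorphism.Build {freeg T / K} M (fglift f)
  (lift_is_additive f).

Lemma fglift_sumE D : fglift f D = \sum_(x <- dom D) coeff x D *: f x.
Proof.
rewrite -{1}[D]freeg_sumE raddf_sum; apply: eq_bigr => x _; exact: liftU.
Qed.

Lemma fgliftZ : scalable (fglift f).
Proof.
move=> c D; rewrite [c *: D]/(fgscale c D) /fgscale raddf_sum /= fglift_sumE scaler_sumr.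
by apply: eq_bigr => x _; rewrite liftU scalerA.
Qed.

HB.instance Definition _ := GRing.isScalable.Build K {freeg T / K} M *:%R (fglift f)
  fgliftZ.

Lemma fglift_basis x : fglift f << x >> = f x.
Proof. by rewrite liftU scale1r. Qed.
End Freeg.

Lemma freeg_linear_ext (K : fieldType) (T : choiceType) (M : lmodType K)
    (f g : {linear {freeg T / K} -> M}) :
  (forall x, f << x >> = g << x >>) -> f =1 g.
Proof.
move=> fg D; rewrite -[D]freeg_sumE !linear_sum; apply: eq_bigr => x _.
have -> : << coeff x D *g x >> = coeff x D *: << x >> :> {freeg T / K}.
  by apply/eqP/freeg_eqP => y; rewrite coeffZ !coeffU mul1r.
by rewrite !linearZ_LR fg.
Qed.

(** * The product of sashes *)

Section Product.
Variable K : fieldType.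

Lemma bullet_S_basis (A B : sash) (p := degree A) (q := degree B) :
  bullet_S (sash_basis K A) (sash_basis K B) =
  \sum_(z : 'S_(p + q) | is_shifted_shuffle (eta p A) (eta q B) z && pell z)
     sash_basis K (sigma z).
Proof.
rewrite /bullet_S /eta_lin /sash_basis !fglift_basis /bullet /perms_basis !fglift_basis /=.
rewrite /shuffle_sum /rho_lin /sigma_lin !linear_sum [RHS]big_mkcondr /=.
apply: eq_bigr => z _; rewrite /perms_basis fglift_basis /=.
by case: ifP => _; rewrite ?fglift_basis ?linear0.
Qed.

Let sigma1 (x : perms) : sash_space K := sash_basis K (sigma (tagged x)).
Let rho1 (x : perms) : perm_space K :=
  if pell (tagged x) then perms_basis K (tagged x) else 0.
Let eta1 (A : sash) : perm_space K := perms_basis K (eta (degree A) A).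
Let shuffle1 (x y : perms) : perm_space K := shuffle_sum K (tagged x) (tagged y).

Lemma bullet_S_linear_l b : exists f : {linear sash_space K -> sash_space K},
  forall a, bullet_S a b = f a.
Proof.
by exists (fglift sigma1 \o fglift rho1 \o
  fglift (fun x => fglift (shuffle1 x) (eta_lin b)) \o fglift eta1).
Qed.

Lemma bullet_S_linear_r A : exists f : {linear sash_space K -> sash_space K},
  forall b, bullet_S (sash_basis K A) b = f b.
Proof.
exists (fglift sigma1 \o fglift rho1 \o
  fglift (shuffle1 (existT (fun n => 'S_n) (degree A) (eta (degree A) A))) \o fglift eta1) => b.
by rewrite /bullet_S /eta_lin /sash_basis fglift_basis /bullet /perms_basis fglift_basis.
Qed.

(** The types ['S_(n + 0)] and ['S_n] are not convertible, but one-line words do not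
    see the difference. *)
Lemma cast_oneline m n (x : 'S_n) : m = n ->
  exists z : 'S_m, [/\ oneline z = oneline x, pell z = pell x & sigma z = sigma x].
Proof. by move=> ->; exists x. Qed.

Lemma oneline0 (x : 'S_0) : oneline x = [::].
Proof. by apply: size0nil; rewrite size_oneline. Qed.

Lemma bullet_S_None_basis A :
  bullet_S (sash_basis K None) (sash_basis K A) = sash_basis K A.
Proof.
rewrite bullet_S_basis; set q := degree A; have [Pe se] := @etaP q A erefl.
rewrite (big_pred1 (eta q A)) ?se // => z; rewrite /= /is_shifted_shuffle oneline0.
have pos v : v \in oneline z -> (0 < v)%N.
  by rewrite mem_perm_word ?perm_word_oneline // => /andP[].
rewrite (eq_in_filter (a2 := pred0)); last by move=> v /pos; rewrite lt0n leqn0 => /negPf.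
rewrite filter_pred0 eqxx (eq_in_filter (a2 := predT)) // filter_predT /=.
rewrite (eq_map (g := id)) ?map_id; last exact: addn0.
by apply/andP/eqP => [[/eqP/oneline_inj]|->].
Qed.

Lemma bullet_S_basis_None A :
  bullet_S (sash_basis K A) (sash_basis K None) = sash_basis K A.
Proof.
rewrite bullet_S_basis; set p := degree A; have [Pe se] := @etaP p A erefl.
have [x [ox px sx]] := cast_oneline (eta p A) (addn0 p).
rewrite (big_pred1 x) ?sx ?se // => z; rewrite /= /is_shifted_shuffle oneline0 -ox.
have le_p v : v \in oneline z -> (v <= p)%N.
  by rewrite mem_perm_word ?perm_word_oneline // size_oneline addn0 => /andP[].
rewrite [X in _ && (X == _)](eq_in_filter (a2 := pred0)).
  rewrite filter_pred0 eqxx andbT (eq_in_filter (a2 := predT)) // filter_predT /=.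
  by apply/andP/eqP => [[/eqP/oneline_inj]|->]; rewrite ?px.
by move=> v /le_p; rewrite leqNgt => /negPf.
Qed.

Lemma size_word_length (S : seq tile) : (size S <= word_length S)%N.
Proof.
by rewrite /word_length; elim: S => //= -[] S IH; rewrite ?add1n ?add2n ltnS // ltnW.
Qed.

(** Reindexing along the bijection sigma; among all permutations, those fixed by
    eta after sigma are the Pell ones. *)
Lemma interval_sum_perm (D E : seq tile) n : (word_length D).+1 = n ->
  interval_sum K D E =
  \sum_(z : 'S_n | [&& pell z, sash_le n (Some D) (sigma z) &
                      sash_le n (sigma z) (Some E)])
     sash_basis K (sigma z).
Proof.
move=> <-; rewrite /interval_sum; set m := word_length D; set n' := m.+1.
have len (z : 'S_n') : word_length (sash_word (oneline z)) = m.
  by rewrite word_length_sash_word size_oneline.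
have size_le (z : 'S_n') : (size (sash_word (oneline z)) <= m)%N.
  by rewrite -(len z) size_word_length.
rewrite (reindex_onto (fun z => Bseq (size_le z))
                      (fun C => eta n' (Some (C : seq tile)))).
  have sE (z : 'S_n') : Some (Bseq (size_le z) : seq tile) = sigma z.
    by rewrite sigma_oneline.
  apply: eq_big => z; last by rewrite sE.
  rewrite inE !sE len eqxx andTb andbC.
  congr (_ && _); apply/eqP/idP => [<-|]; last exact: eta_sigma.
  by case: (etaP (degree_sigma z)).
move=> C; rewrite inE => /andP[/eqP Cm _]; apply/val_inj/Some_inj.
rewrite -[Some (val (Bseq _))]sigma_oneline //.
have [] := @etaP n' (Some (C : seq tile)) => //.
by rewrite /= Cm.
Qed.

Lemma bullet_S_interval (A B F : seq tile) : upper_end A F ->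
  bullet_S (sash_basis K (Some A)) (sash_basis K (Some B)) =
  interval_sum K (A ++ [:: Black] ++ B) (F ++ B).
Proof.
move=> AF; set p := (word_length A).+1; set q := (word_length B).+1.
rewrite bullet_S_basis (@interval_sum_perm _ _ (p + q)) /=.
  apply: eq_bigl => z; rewrite andbC; case Pz: (pell z) => //=.
  exact: shuffle_interval.
by rewrite word_length_cat /p /q -addSn.
Qed.

End Product.

Theorem proposition3p1 (K : fieldType) :
  (forall a : sash_space K,
     bullet_S (sash_basis K None) a = a /\
     bullet_S a (sash_basis K None) = a) /\
  (forall A B : seq tile,
     (forall A' : seq tile, A = A' ++ [:: Black] ->
        bullet_S (sash_basis K (Some A)) (sash_basis K (Some B)) =
        interval_sum K (A ++ [:: Black] ++ B) (A' ++ [:: Rect] ++ B)) /\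
     ((forall A' : seq tile, A <> A' ++ [:: Black]) ->
        bullet_S (sash_basis K (Some A)) (sash_basis K (Some B)) =
        interval_sum K (A ++ [:: Black] ++ B) (A ++ [:: White] ++ B))).
Proof.
split=> [a|A B]; split.
- have [f fE] := bullet_S_linear_r K None; rewrite fE.
  by apply: (freeg_linear_ext (g := idfun)) => A; rewrite -fE; apply: bullet_S_None_basis.
- have [f fE] := bullet_S_linear_l (sash_basis K None); rewrite fE.
  by apply: (freeg_linear_ext (g := idfun)) => A; rewrite -fE; apply: bullet_S_basis_None.
- move=> A' ->; rewrite [A' ++ [:: Rect] ++ B]catA.
  by apply/bullet_S_interval/upper_end_Rect.
- move=> nA; rewrite [A ++ [:: White] ++ B]catA.
  by apply/bullet_S_interval/upper_end_White.
Qed.
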